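(* Let $\mathcal V=(V,\le,\otimes,k)$ be a commutative quantale with $k=\top$, and let $(X,a)$ and $(Y,b)$ be objects of $\mathcal V\text{-}\mathbf{Mon}^*$. Then, up to isomorphism, there is a one-to-one correspondence between $U$-Schreier split extensions $(X,a)\overset{\kappa}{\hookrightarrow}(Z,c)\overset{p}{\underset{s}{\rightleftarrows}}(Y,b)$ of $\mathcal V$-monoids with $(Z,c)$ lying in $\mathcal V\text{-}\mathbf{Mon}^*$, and $\mathcal V$-enriched actions of $(Y,b)$ on $(X,a)$.
   Context: A quantale $\mathcal V=(V,\le,\otimes,k)$ is a complete lattice $(V,\le)$ with a monoid structure $(V,\otimes,k)$ such that $\otimes$ preserves arbitrary joins in each variable; it is commutative if $\otimes$ is; $\top$ is the top element of $V$. A $\mathcal V$-category is a pair $(X,a)$ with $a:X\times X\to V$ reflexive ($k\le a(x,x)$) and transitive ($a(x,y)\otimes a(y,z)\le a(x,z)$). A $\mathcal V$-functor $(X,a)\to(Y,b)$ is a map $f$ with $a(x,x')\le b(f(x),f(x'))$. A $\mathcal V$-monoid $(X,a,+)$ is a $\mathcal V$-category $(X,a)$ with a monoid structure $(X,+)$ such that $a(x_1,y_1)\otimes a(x_2,y_2)\le a(x_1+x_2,y_1+y_2)$ always. Morphisms of $\mathcal V$-monoids are maps that are both $\mathcal V$-functors and monoid homomorphisms. $X$ is written additively with unit $0$ (but is not assumed commutative), $Y$ multiplicatively with unit $1$, and the operation of $Z$ is $\star$. For a $\mathcal V$-monoid $(X,a)$ let $P_a:X\to V$, $P_a(x)=a(0,x)$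 (unit of $X$ in the first argument; so $P_b(y)=b(1,y)$). $\mathcal V\text{-}\mathbf{Mon}^*$ is the full subcategory of the category of $\mathcal V$-monoids on those $(X,a)$ with $a(x,y)=\bigvee\{P_a(w)\mid w\in X,\ y=w+x\}$ for all $x,y\in X$. A $U$-Schreier split extension of $\mathcal V$-monoids is a diagram $(X,a)\overset{\kappa}{\hookrightarrow}(Z,c)\overset{p}{\underset{s}{\rightleftarrows}}(Y,b)$ of $\mathcal V$-monoid morphisms such that $p\circ s=\mathrm{id}_Y$; $\kappa$ is the kernel of $p$ in the category of $\mathcal V$-monoids, i.e. $\kappa$ is an injective monoid homomorphism with image $\{z\in Z\mid p(z)=1\}$ and $a(x,x')=c(\kappa(x),\kappa(x'))$ for all $x,x'\in X$; and there exists a unique set map $q:Z\to X$ with $z=\kappa(q(z))\star s(p(z))$ for all $z\in Z$. Two such extensions of $(Y,b)$ by $(X,a)$, with middle objects $(Z,c)$ and $(Z',c')$, are isomorphic if there is an isomorphism of $\mathcal V$-monoids $(Z,c)\to(Z',c')$ commuting with the respective kernels $\kappa$, maps $p$ and sections $s$ (and being the identity on $X$ and $Y$). A monoid action of $Y$ on $X$ is a map $\alpha:Y\times X\to X$ with $\alpha(1,x)=x$, $\alpha(yy',x)=\alpha(y,\alpha(y',x))$, $\alpha(y,0)=0$, $\alpha(y,x+x')=\alpha(y,x)+\alpha(y,x')$. A $\mathcal V$-enriched action of $(Y,b)$ on $(X,a)$ is a pair $(\alpha,P)$ where $\alpha:Y\times X\to X$ is a monoid action and $P:X\times Y\to V$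 is a function such that: (E.0) $P(x,y)\le P_b(y)$ for all $(x,y)\in X\times Y$; (E.1) $P_b(y)\le P(0,y)$ for all $y\in Y$; (E.2) $P_a(x)=P(x,1)$ for all $x\in X$; (E.3) $P(x,y)\otimes P(x',y')\le P(x+\alpha(y,x'),yy')$ for all $(x,y),(x',y')\in X\times Y$; (E.4) $P(x,y)\le\bigvee\{P(x',y')\mid x_0+\alpha(y_0,x)=x'+\alpha(y',x_0)\text{ and }y_0y=y'y_0\}$ for all $(x,y),(x_0,y_0)\in X\times Y$. *)

(* Defs.v *)
From HB Require Import structures.
From mathcomp Require Import all_boot all_order.
From mathcomp Require Import boolp classical_sets.

Set Implicit Arguments.
Unset Strict Implicit.
Unset Printing Implicit Defensive.

Local Open Scope classical_set_scope.
Local Open Scope order_scope.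
Local Open Scope group_scope.

(** All monoids are written multiplicatively, as in [monoidType]: the tensor
    and unit of a quantale are [*] and [1], and so are [+] and [0] of a
    (noncommutative) additive monoid. *)

HB.mixin Record isQuantale (d : Order.disp_t) V
    of Order.TBLattice d V & Monoid V := {
  bigjoin : set V -> V;
  bigjoin_lub : forall A : set V, isLub A (bigjoin A);
  mul_bigjoinr : forall (u : V) (A : set V),
    u * bigjoin A = bigjoin [set u * v | v in A];
  mul_bigjoinl : forall (u : V) (A : set V),
    bigjoin A * u = bigjoin [set v * u | v in A]
}.

#[short(type="quantaleType")]
HB.structure Definition Quantale (d : Order.disp_t) :=
  {V of isQuantale d V & Order.TBLattice d V & Monoid V}.

HB.mixin Record isVCategory (d : Order.disp_t) (V : quantaleType d) X := {
  vhom : X -> X -> V;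
  vhom_refl : forall x : X, 1 <= vhom x x;
  vhom_trans : forall x y z : X, vhom x y * vhom y z <= vhom x z
}.

#[short(type="vcategoryType")]
HB.structure Definition VCategory (d : Order.disp_t) (V : quantaleType d) :=
  {X of isVCategory d V X}.

HB.mixin Record VCategory_isVMonoid (d : Order.disp_t) (V : quantaleType d) X
    of isVCategory d V X & Monoid X := {
  vhom_mul : forall x1 y1 x2 y2 : X,
    (vhom x1 y1 : V) * vhom x2 y2 <= vhom (x1 * x2) (y1 * y2)
}.

#[short(type="vmonoidType")]
HB.structure Definition VMonoid (d : Order.disp_t) (V : quantaleType d) :=
  {X of VCategory_isVMonoid d V X & isVCategory d V X & Monoid X}.

Section VMonoids.
Context {d : Order.disp_t} {V : quantaleType d}.

Definition vfunctor (X Y : vcategoryType V) (f : X -> Y) : Prop :=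
  forall x x' : X, vhom x x' <= vhom (f x) (f x').

Definition vmonoid_morphism (X Y : vmonoidType V) (f : X -> Y) : Prop :=
  vfunctor f /\ monoid_morphism f.

(** The "positive cone" [P_a] of a [V]-monoid [(X, a)]. *)
Definition cone (X : vmonoidType V) (x : X) : V := vhom 1 x.

Definition in_VMon_star (X : vmonoidType V) : Prop :=
  forall x y : X, vhom x y = bigjoin [set cone w | w in [set w | y = w * x]].

(** The kernel of [proj] in [V]-monoids is spelled out as an injective
    homomorphism onto [proj = 1] carrying the induced [V]-category structure. *)
Record schreier_ext (X Y : vmonoidType V) := SchreierExt {
  mid : vmonoidType V;
  ker : X -> mid;
  proj : mid -> Y;
  sect : Y -> mid;
  ker_morphism : vmonoid_morphism ker;
  proj_morphism : vmonoid_morphism proj;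
  sect_morphism : vmonoid_morphism sect;
  sectK : cancel sect proj;
  ker_inj : injective ker;
  ker_range : range ker = [set z | proj z = 1];
  ker_vhom : forall x x' : X, vhom x x' = vhom (ker x) (ker x');
  schreier_retraction :
    exists! q : mid -> X, forall z : mid, z = ker (q z) * sect (proj z)
}.

Definition ext_iso (X Y : vmonoidType V) (E E' : schreier_ext X Y) : Prop :=
  exists (f : mid E -> mid E') (g : mid E' -> mid E),
    [/\ vmonoid_morphism f /\ vmonoid_morphism g,
        cancel f g /\ cancel g f,
        forall x : X, f (ker E x) = ker E' x,
        forall z : mid E, proj (f z) = proj z
      & forall y : Y, f (sect E y) = sect E' y].

Definition monoid_action (X Y : vmonoidType V) (alpha : Y -> X -> X) : Prop :=
  [/\ forall x, alpha 1 x = x,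
      forall y y' x, alpha (y * y') x = alpha y (alpha y' x),
      forall y, alpha y 1 = 1
    & forall y x x', alpha y (x * x') = alpha y x * alpha y x'].

Record enriched_action (X Y : vmonoidType V) := EnrichedAction {
  act : Y -> X -> X;
  acone : X -> Y -> V;
  act_monoid : monoid_action act;
  acone_le : forall x y, acone x y <= cone y;
  acone_ge : forall y, cone y <= acone 1 y;
  acone1 : forall x, cone x = acone x 1;
  acone_mul : forall x y x' y',
    acone x y * acone x' y' <= acone (x * act y x') (y * y');
  acone_shift : forall x y x0 y0,
    acone x y <= bigjoin [set v | exists (x' : X) (y' : Y),
      [/\ x0 * act y0 x = x' * act y' x0,
          y0 * y = y' * y0
        & v = acone x' y']]
}.

(** The enriched action attached to an extension: with [q] its retraction,
    [alpha(y, x) = q (s y * k x)], and [P] is the cone of the middle object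
    transported along [(x, y) |-> k x * s y]. *)
Definition induced_action (X Y : vmonoidType V)
    (E : schreier_ext X Y) (A : enriched_action X Y) : Prop :=
  (forall q : mid E -> X, (forall z, z = ker E (q z) * sect E (proj z)) ->
     forall y x, act A y x = q (sect E y * ker E x)) /\
  (forall x y, acone A x y = cone (ker E x * sect E y)).

End VMonoids.

(* Main.v *)
Require Import Defs.
From HB Require Import structures.
From mathcomp Require Import all_boot all_order.
From mathcomp Require Import boolp classical_sets.

(** An object [Z] of V-Mon* is a monoid together with its cone, since the
    cone determines the V-structure.  The cones that arise this way are exactly
    the functions [P : Z -> V] that are lax monoidal and satisfy the shift
    condition [P w <= \/ {P w' | z * w = w' * z}], an invariance of [P] under
    inner conjugation, phrased without inverses ([cone_shift] for necessity,
    [cone_vmonoid] for sufficiency).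

    On the side of monoids, uniqueness of the retraction makes
    [(x, y) |-> ker x * sect y] a bijection from [X * Y] onto the middle object
    of a Schreier extension ([ker_sect_inj]), and it turns the
    multiplication of the middle object into the semidirect product of the
    action [sect y * ker x = ker (alpha y x) * sect y].  The axioms of an
    enriched action are then what remains to be said about the cone transported
    to [X * Y]: [acone_le] makes the projection a V-functor, [acone_ge] does the
    same for the section, [acone1] gives the kernel the induced structure,
    [acone_mul] is lax monoidality and [acone_shift] is the shift condition.  So
    an extension induces an action ([extension_induces_action]) and the
    semidirect product realizes every action ([semidirect_ext_induced]).

    Finally, two extensions inducing the same action are compared by
    [ker x * sect y |-> ker' x * sect' y].  It is a homomorphism preserving
    cones, and between objects of V-Mon* such a homomorphism is a V-functor
    ([comparison]); exchanging the two extensions gives its inverse. *)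

Set Implicit Arguments.
Unset Strict Implicit.
Unset Printing Implicit Defensive.

Import Order.TTheory.

Local Open Scope classical_set_scope.
Local Open Scope order_scope.
Local Open Scope group_scope.

(** * Joins in a quantale *)

Section QuantaleTheory.
Context {d : Order.disp_t} {V : quantaleType d}.
Implicit Types (u v w : V) (A B : set V).

Lemma le_bigjoin A v : A v -> v <= bigjoin A.
Proof. by have [ubA _] := bigjoin_lub A => /ubA. Qed.

Lemma bigjoin_le A u : (forall v, A v -> v <= u) -> bigjoin A <= u.
Proof. by have [_ lubA] := bigjoin_lub A => /lubA. Qed.

Lemma bigjoin_mul_le A B w :
  (forall u v, A u -> B v -> u * v <= w) -> bigjoin A * bigjoin B <= w.
Proof.
move=> le_w; rewrite mul_bigjoinl; apply: bigjoin_le => _ [u Au <-].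
by rewrite mul_bigjoinr; apply: bigjoin_le => _ [v Bv <-]; apply: le_w.
Qed.

(** Preservation of joins gives monotonicity because [u <= v] says that [v] is
    the join of [u] and [v]. *)
Lemma leM2l w u v : u <= v -> w * u <= w * v.
Proof.
move=> le_uv; have -> : v = bigjoin [set u; v].
  apply/le_anti; rewrite le_bigjoin; last by right.
  by apply: bigjoin_le => _ [->|->].
by rewrite mul_bigjoinr; apply: le_bigjoin; exists u => //; left.
Qed.

Lemma leM2r w u v : u <= v -> u * w <= v * w.
Proof.
move=> le_uv; have -> : v = bigjoin [set u; v].
  apply/le_anti; rewrite le_bigjoin; last by right.
  by apply: bigjoin_le => _ [->|->].
by rewrite mul_bigjoinl; apply: le_bigjoin; exists u => //; left.
Qed.

End QuantaleTheory.

(** * Objects of V-Mon* and their cones *)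

Section Cones.
Context {d : Order.disp_t} {V : quantaleType d}.

Lemma cone_mul_le (Z : vmonoidType V) (z w : Z) :
  cone z * cone w <= cone (z * w) :> V.
Proof. by apply: le_trans (vhom_mul _ _ _ _) _; rewrite mulg1. Qed.

Lemma cone_le_vhom (Z : vmonoidType V) (z w : Z) :
  cone w <= vhom z (w * z) :> V.
Proof.
rewrite -{1}[z]mul1g; apply: le_trans (vhom_mul _ _ _ _).
by rewrite -{1}[cone w]mulg1 leM2l // vhom_refl.
Qed.

Lemma cone_le_vhomr (Z : vmonoidType V) (z w : Z) :
  cone w <= vhom z (z * w) :> V.
Proof.
rewrite -{1}[z]mulg1; apply: le_trans (vhom_mul _ _ _ _).
by rewrite -{1}[cone w]mul1g leM2r // vhom_refl.
Qed.

(** The structure of [Z] is described by left translations, but right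
    translations are V-functors too; the shift condition compares both. *)
Lemma cone_shift (Z : vmonoidType V) (hZ : in_VMon_star Z) (z w : Z) :
  cone w <= bigjoin [set cone w' | w' in [set w' | z * w = w' * z]] :> V.
Proof. by rewrite -hZ cone_le_vhomr. Qed.

Lemma vmonoid_morphism_cone (Z T : vmonoidType V) (f : Z -> T) (z : Z) :
  vmonoid_morphism f -> cone z <= cone (f z) :> V.
Proof. by move=> [fV [f1 _]]; rewrite /cone -f1 fV. Qed.

Lemma vfunctor_of_cone (Z T : vmonoidType V) (f : Z -> T) :
    in_VMon_star Z -> {morph f : z w / z * w} ->
    (forall z, cone z <= cone (f z) :> V) ->
  vfunctor f.
Proof.
move=> hZ fM f_cone z z'; rewrite hZ; apply: bigjoin_le => _ [w -> <-].
by rewrite fM; apply: le_trans (f_cone w) (cone_le_vhom _ _).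
Qed.

Section ConeVMonoid.
Context (Z : monoidType) (P : Z -> V).
Hypothesis mulV_comm : forall u v : V, u * v = v * u.
Hypothesis P1 : 1 <= P 1.
Hypothesis PM : forall z w, P z * P w <= P (z * w).
Hypothesis P_shift : forall z w,
  P w <= bigjoin [set P w' | w' in [set w' | z * w = w' * z]].

Let hom (z z' : Z) : V := bigjoin [set P w | w in [set w | z' = w * z]].

Let hom_refl z : 1 <= hom z z.
Proof.
by apply: le_trans P1 _; apply: le_bigjoin; exists 1; rewrite //= mul1g.
Qed.

(* Composing translations by [w] and [w'] gives [w' * w], in the order
   opposite to composition of homs: commutativity of the tensor enters here. *)
Let hom_trans z1 z2 z3 : hom z1 z2 * hom z2 z3 <= hom z1 z3.
Proof.
apply: bigjoin_mul_le => _ _ [w -> <-] [w' -> <-].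
rewrite mulV_comm; apply: le_trans (PM _ _) _.
by apply: le_bigjoin; exists (w' * w); rewrite //= mulgA.
Qed.

Let hom_mul z1 w1 z2 w2 :
  hom z1 w1 * hom z2 w2 <= hom (z1 * z2) (w1 * w2).
Proof.
apply: bigjoin_mul_le => _ _ [u -> <-] [v -> <-].
(* In [(u * z1) * (v * z2)] the factor [v] has to be moved to the left of [z1]. *)
apply: le_trans (leM2l _ (P_shift z1 v)) _.
rewrite mul_bigjoinr; apply: bigjoin_le => _ [_ [v' z1v <-] <-].
apply: le_trans (PM _ _) _; apply: le_bigjoin; exists (u * v') => //=.
by rewrite -[RHS]mulgA (mulgA v') -z1v !mulgA.
Qed.

(** The monoid [Z] with the only V-structure in V-Mon* whose cone is [P]. *)
Definition cone_vmonoid : vmonoidType V :=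
  let C := isVCategory.Build d V Z hom_refl hom_trans in
  let ZC : vcategoryType V := HB.pack (Monoid.sort Z) C in
  HB.pack (Monoid.sort Z) C (VCategory_isVMonoid.Build d V ZC hom_mul).

Lemma cone_cone_vmonoid (z : cone_vmonoid) : cone z = P z.
Proof.
apply/le_anti; rewrite bigjoin_le => [|_ [w -> <-]]; last by rewrite mulg1.
by rewrite le_bigjoin //; exists z; rewrite //= mulg1.
Qed.

Lemma cone_vmonoid_star : in_VMon_star cone_vmonoid.
Proof.
move=> z z'; congr bigjoin.
by apply/seteqP; split=> _ [w z'E <-]; exists w => //; rewrite cone_cone_vmonoid.
Qed.

End ConeVMonoid.
End Cones.

(** * From extensions to actions *)

Section EnrichedActionTheory.
Context {d : Order.disp_t} {V : quantaleType d} {X Y : vmonoidType V}.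

Lemma enriched_action_eq (A A' : enriched_action X Y) :
  act A =2 act A' -> acone A =2 acone A' -> A = A'.
Proof.
case: A A' => [al P ? ? ? ? ? ?] [al' P' ? ? ? ? ? ?] /= eq_al eq_P.
have ?: al = al' by apply/funext => y; apply/funext => x; exact: eq_al.
have ?: P = P' by apply/funext => x; apply/funext => y; exact: eq_P.
by subst al' P'; f_equal; exact: Prop_irrelevance.
Qed.

End EnrichedActionTheory.

Section ExtensionTheory.
Context {d : Order.disp_t} {V : quantaleType d} {X Y : vmonoidType V}.
Implicit Type E : schreier_ext X Y.

Lemma ker1 E : ker E 1 = 1.
Proof. by have [_ []] := ker_morphism E. Qed.

Lemma kerM E : {morph ker E : x x' / x * x'}.
Proof. by have [_ []] := ker_morphism E. Qed.

Lemma sect1 E : sect E 1 = 1.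
Proof. by have [_ []] := sect_morphism E. Qed.

Lemma sectM E : {morph sect E : y y' / y * y'}.
Proof. by have [_ []] := sect_morphism E. Qed.

Lemma projM E : {morph @proj _ _ _ _ E : z z' / z * z'}.
Proof. by have [_ []] := proj_morphism E. Qed.

Lemma proj_ker E x : proj (ker E x) = 1.
Proof.
by have : range (ker E) (ker E x) by [exists x]; rewrite ker_range.
Qed.

Lemma proj_ker_sect E x y : proj (ker E x * sect E y) = y.
Proof. by rewrite projM proj_ker mul1g sectK. Qed.

Lemma ker_sect_surj E z : exists x, z = ker E x * sect E (proj z).
Proof. by have [q [qE _]] := schreier_retraction E; exists (q z). Qed.

(** The retraction [q] is only assumed unique as a function; as its values can
    be changed at a single point, each of them is unique. *)
Lemma ker_sect_inj E x y x' y' :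
  ker E x * sect E y = ker E x' * sect E y' -> x = x' /\ y = y'.
Proof.
move=> xyE; have /(congr1 (@proj _ _ _ _ E)) := xyE.
rewrite !proj_ker_sect => ?; subst y'; split=> //.
have [q [qE q_uniq]] := schreier_retraction E.
have q_val w : ker E w * sect E y = ker E x * sect E y ->
    q (ker E x * sect E y) = w.
  move=> wE; pose q' z := if pselect (z = ker E x * sect E y) then w else q z.
  rewrite (q_uniq q') /q'; first by case: pselect.
  by move=> z; case: pselect => //= ->; rewrite proj_ker_sect.
by rewrite -(q_val x) // (q_val x').
Qed.

(** An action is induced by [E] when it governs how sections move past
    kernels; this form does not mention the retraction. *)
Lemma induced_actionP E (A : enriched_action X Y) :
  induced_action E A <->
  (forall y x, sect E y * ker E x = ker E (act A y x) * sect E y) /\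
  (forall x y, acone A x y = cone (ker E x * sect E y)).
Proof.
have proj_sk y x : proj (sect E y * ker E x) = y.
  by rewrite projM sectK proj_ker mulg1.
split=> -[actE aconeE]; split=> //.
  move=> y x; have [q [qE _]] := schreier_retraction E.
  by rewrite (actE q qE) {1}(qE (sect E y * ker E x)) proj_sk.
move=> q qE y x; have := qE (sect E y * ker E x).
by rewrite proj_sk {1}actE => /ker_sect_inj [].
Qed.

Lemma induced_action_uniq E (A A' : enriched_action X Y) :
  induced_action E A -> induced_action E A' -> A = A'.
Proof.
move=> /induced_actionP[actE coneE] /induced_actionP[actE' coneE'].
apply: enriched_action_eq => [y x|x y]; last by rewrite coneE coneE'.
by have := actE y x; rewrite actE' => /ker_sect_inj [].
Qed.

Lemma extension_induces_action E :
  in_VMon_star (mid E) -> exists A : enriched_action X Y, induced_action E A.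
Proof.
move=> hE; have [al alE] : exists al : Y -> X -> X,
    forall y x, sect E y * ker E x = ker E (al y x) * sect E y.
  have [q [qE _]] := schreier_retraction E.
  exists (fun y x => q (sect E y * ker E x)) => y x.
  by rewrite {1}(qE (sect E y * ker E x)) projM sectK proj_ker mulg1.
have al_val y x w : sect E y * ker E x = ker E w * sect E y -> al y x = w.
  by rewrite alE => /ker_sect_inj [].
have ksM x y x' y' : ker E x * sect E y * (ker E x' * sect E y') =
    ker E (x * al y x') * sect E (y * y').
  by rewrite mulgA -(mulgA (ker E x)) alE kerM sectM !mulgA.
pose P x y : V := cone (ker E x * sect E y).
have al_action : monoid_action al.
  split=> [x|y y' x|y|y x x']; apply: al_val.
  - by rewrite sect1 mul1g mulg1.
  - by rewrite sectM -mulgA alE mulgA alE -mulgA.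
  - by rewrite ker1 mul1g mulg1.
  - by rewrite !kerM mulgA alE -mulgA alE mulgA.
have P_le x y : P x y <= cone y.
  rewrite -{2}(proj_ker_sect E x y).
  exact: vmonoid_morphism_cone (proj_morphism E).
have P_ge y : cone y <= P 1 y.
  rewrite /P ker1 mul1g; exact: vmonoid_morphism_cone (sect_morphism E).
have P1 x : cone x = P x 1.
  by rewrite /P sect1 mulg1 /cone (ker_vhom E) ker1.
have PM x y x' y' : P x y * P x' y' <= P (x * al y x') (y * y').
  by rewrite /P -ksM cone_mul_le.
have P_shift x y x0 y0 : P x y <= bigjoin [set v | exists x' y',
    [/\ x0 * al y0 x = x' * al y' x0, y0 * y = y' * y0 & v = P x' y']].
  apply: le_trans (cone_shift hE (ker E x0 * sect E y0) _) _.
  apply: bigjoin_le => _ [w zw <-]; apply: le_bigjoin => /=.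
  have [x' wE] := ker_sect_surj w; move: zw; rewrite /= wE !ksM.
  by case/ker_sect_inj => ? ?; exists x', (proj w).
pose A := EnrichedAction al_action P_le P_ge P1 PM P_shift.
by exists A; apply/induced_actionP.
Qed.

(** * Comparison of extensions inducing the same action *)

(** Both multiplications are given by [act A] and both cones by [acone A] in the
    coordinates [ker x * sect y], so matching coordinates preserves them. *)
Lemma comparison E E' (A : enriched_action X Y) :
    in_VMon_star (mid E) -> induced_action E A -> induced_action E' A ->
  exists f : mid E -> mid E', vmonoid_morphism f /\
    (forall x y, f (ker E x * sect E y) = ker E' x * sect E' y).
Proof.
move=> hE /induced_actionP[actE coneE] /induced_actionP[actE' coneE'].
have [q [qE _]] := schreier_retraction E.
pose f z := ker E' (q z) * sect E' (proj z).
have fE x y : f (ker E x * sect E y) = ker E' x * sect E' y.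
  rewrite /f proj_ker_sect; have := qE (ker E x * sect E y).
  by rewrite proj_ker_sect => /ker_sect_inj [<-].
exists f; split=> //.
have fM : {morph f : z w / z * w}.
  move=> z w; have [x ->] := ker_sect_surj z.
  have [x' ->] := ker_sect_surj w; move: (proj z) (proj w) => y y'.
  rewrite !fE mulgA -(mulgA (ker E x)) actE mulgA -kerM -mulgA -sectM fE.
  by rewrite [RHS]mulgA -(mulgA (ker E' x)) actE' kerM sectM !mulgA.
have f1 : f 1 = 1 by have := fE 1 1; rewrite !ker1 !sect1 !mulg1.
split=> //; apply: vfunctor_of_cone => // z.
by have [x ->] := ker_sect_surj z; rewrite fE -coneE -coneE'.
Qed.

Lemma ext_iso_of_common_action E E' (A : enriched_action X Y) :
    in_VMon_star (mid E) -> in_VMon_star (mid E') ->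
    induced_action E A -> induced_action E' A ->
  ext_iso E E'.
Proof.
move=> hE hE' EA E'A.
have [f [fV fE]] := comparison hE EA E'A.
have [g [gV gE]] := comparison hE' E'A EA.
exists f, g; split=> // [|x|z|y].
- by split=> z; have [x ->] := ker_sect_surj z; rewrite ?(fE, gE).
- by have := fE x 1; rewrite !sect1 !mulg1.
- by have [x ->] := ker_sect_surj z; rewrite fE !proj_ker_sect.
- by have := fE 1 y; rewrite !ker1 !mul1g.
Qed.

Lemma induced_action_iso E E' (A : enriched_action X Y) :
  ext_iso E E' -> induced_action E A -> induced_action E' A.
Proof.
move=> [f [g [[fV gV] [fK _] f_ker _ f_sect]]] /induced_actionP[actE coneE].
have fM : {morph f : z w / z * w} by have [_ []] := fV.
apply/induced_actionP; split=> [y x|x y].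
  by rewrite -!f_ker -!f_sect -!fM actE.
rewrite coneE -f_ker -f_sect -fM; apply/le_anti.
by rewrite vmonoid_morphism_cone // -{2}[ker E x * _]fK vmonoid_morphism_cone.
Qed.

End ExtensionTheory.

(** * The semidirect product realizing an action *)

(** A synonym of the product type that does not carry the componentwise
    multiplication. *)
Definition semidirect (X Y : Type) : Type := (X * Y)%type.

HB.instance Definition _ (X Y : choiceType) :=
  Choice.copy (semidirect X Y) (X * Y)%type.

Section SemidirectExtension.
Context {d : Order.disp_t} {V : quantaleType d} {X Y : vmonoidType V}.
Hypothesis mulV_comm : forall u v : V, u * v = v * u.
Hypothesis hX : in_VMon_star X.
Hypothesis hY : in_VMon_star Y.
Variable A : enriched_action X Y.

Let act1 : act A 1 =1 id. Proof. by have [] := act_monoid A. Qed.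
Let actM y y' x : act A (y * y') x = act A y (act A y' x).
Proof. by have [] := act_monoid A. Qed.
Let act_1 y : act A y 1 = 1. Proof. by have [] := act_monoid A. Qed.
Let act_mul y x x' : act A y (x * x') = act A y x * act A y x'.
Proof. by have [] := act_monoid A. Qed.

Let mul (z w : semidirect X Y) : semidirect X Y := (z.1 * act A z.2 w.1, z.2 * w.2).

Let mul_assoc : associative mul.
Proof. by move=> z1 z2 z3; rewrite /mul /= act_mul actM !mulgA. Qed.

Let mul_1l : left_id (1, 1) mul.
Proof. by move=> [x y]; rewrite /mul /= act1 !mul1g. Qed.

Let mul_1r : right_id (1, 1) mul.
Proof. by move=> [x y]; rewrite /mul /= act_1 !mulg1. Qed.

Let XY : monoidType :=
  HB.pack (semidirect X Y)
    (isMonoid.Build (semidirect X Y) mul_assoc mul_1l mul_1r).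

Let P (z : XY) : V := acone A z.1 z.2.

Let P1 : 1 <= P 1.
Proof. exact: le_trans (vhom_refl 1) (acone_ge A 1). Qed.

Let PM (z w : XY) : P z * P w <= P (z * w).
Proof. exact: (acone_mul A z.1 z.2 w.1 w.2). Qed.

Let P_shift (z w : XY) :
  P w <= bigjoin [set P w' | w' in [set w' | z * w = w' * z]].
Proof.
apply: le_trans (acone_shift A w.1 w.2 z.1 z.2) _.
apply: bigjoin_le => _ [x' [y' [xE yE ->]]]; apply: le_bigjoin.
by exists ((x', y') : XY) => //; congr pair.
Qed.

Let Z : vmonoidType V := cone_vmonoid mulV_comm P1 PM P_shift.
Let k (x : X) : Z := (x, 1) : XY.
Let s (y : Y) : Z := (1, y) : XY.
Let p (z : Z) : Y := (z : XY).2.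

Let Z_star : in_VMon_star Z. Proof. exact: cone_vmonoid_star. Qed.
Let coneZ (z : Z) : cone z = P z. Proof. exact: cone_cone_vmonoid. Qed.

Let kM : {morph k : x x' / x * x'}.
Proof. by move=> x x'; congr pair; rewrite /= ?act1 ?mul1g. Qed.

Let sM : {morph s : y y' / y * y'}.
Proof. by move=> y y'; congr pair; rewrite /= act_1 mul1g. Qed.

Let k_s (z : Z) : z = k (z : XY).1 * s (p z).
Proof. by case: z => x y; congr pair; rewrite /= ?act_1 ?mulg1 ?mul1g. Qed.

Let k_morphism : vmonoid_morphism k.
Proof.
split; last by split.
by apply: vfunctor_of_cone => // x; rewrite coneZ /P (acone1 A).
Qed.

Let p_morphism : vmonoid_morphism p.
Proof.
split; last by split.
by apply: vfunctor_of_cone => // z; rewrite coneZ acone_le.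
Qed.

Let s_morphism : vmonoid_morphism s.
Proof.
split; last by split.
by apply: vfunctor_of_cone => // y; rewrite coneZ acone_ge.
Qed.

Let k_range : range k = [set z | p z = 1].
Proof.
apply/seteqP; split=> [_ [x _ <-] //|[x y]].
by rewrite /p /= => ->; exists x.
Qed.

(* A translation of [Z] taking [k x] to [k x'] is by an element with trivial
   second component, hence comes from [X]. *)
Let k_vhom x x' : vhom x x' = vhom (k x) (k x').
Proof.
apply/le_anti; rewrite k_morphism.1 /= Z_star.
apply: bigjoin_le => _ [[w y] [x'E yE] <-]; move: yE x'E.
rewrite mulg1 => <-; rewrite coneZ /P /= act1 -(acone1 A) => ->.
exact: cone_le_vhom.
Qed.

Let p_retraction : exists! q : Z -> X, forall z, z = k (q z) * s (p z).
Proof.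
exists (fun z : XY => z.1); split=> [z|q qE]; first exact: k_s.
by apply/funext => z; rewrite {1}(qE z) /= act_1 mulg1.
Qed.

Let E : schreier_ext X Y.
Proof.
apply: (@SchreierExt _ _ X Y Z k p s) => //.
by move=> x x' [].
Defined.

Lemma semidirect_ext_induced :
  exists2 E : schreier_ext X Y, in_VMon_star (mid E) & induced_action E A.
Proof.
exists E => //; apply/induced_actionP; split=> [y x|x y] /=.
  by congr pair; rewrite /= ?act_1 ?mulg1 ?mul1g.
by rewrite coneZ /P /= act_1 mulg1 mul1g.
Qed.

End SemidirectExtension.

Theorem theorem5p3 (d : Order.disp_t) (V : quantaleType d)
    (mulV_comm : forall u v : V, (u * v = v * u)%g)
    (unit_top : 1%g = (\top)%O :> V)
    (X Y : vmonoidType V) (hX : in_VMon_star X) (hY : in_VMon_star Y) :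
  exists Phi : {E : schreier_ext X Y | in_VMon_star (mid E)} ->
               enriched_action X Y,
    [/\ forall E, induced_action (sval E) (Phi E),
        forall E E', ext_iso (sval E) (sval E') <-> Phi E = Phi E'
      & forall A : enriched_action X Y, exists E, Phi E = A].
Proof.
have [Phi PhiP] := choice (fun E : {E : schreier_ext X Y | in_VMon_star (mid E)}
  => extension_induces_action (svalP E)).
exists Phi; split=> // [E E'|A].
- split=> [isoEE'|PhiE].
    exact: induced_action_uniq (induced_action_iso isoEE' (PhiP E)) (PhiP E').
  apply: ext_iso_of_common_action (svalP E) (svalP E') (PhiP E) _.
  by rewrite PhiE.
- have [E hE EA] := semidirect_ext_induced mulV_comm hX hY A.
  exists (exist _ E hE).
  exact: induced_action_uniq (PhiP (exist _ E hE)) EA.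
Qed.
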